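(* Let $m,n$ be positive integers and let $(X_{1,1},\ldots,X_{m,n})$ be a uniform random variable on $\mathcal{X}_{m,n}$. Then for every integer $k$ with $n\leq k\leq mn-m+1$, $$\mathbb{P}(X_{1,n}=k)=\frac{\binom{k-1}{n-1}\binom{mn-k}{m-1}}{\binom{mn}{m+n-1}}.$$
   Context: For positive integers $m,n$, a rectangular Young tableau of size $(m,n)$ is an $mn$-tuple of integers $(X_{i,j})_{1\le i\le m,\,1\le j\le n}$ such that $\{X_{1,1},\ldots,X_{m,n}\}=\{1,2,\ldots,mn\}$ and, for all $i,j$, $X_{i,j}<\min(X_{i,j+1},X_{i+1,j})$ (inequalities involving indices outside the rectangle are omitted). $\mathcal{X}_{m,n}$ denotes the finite set of all such $mn$-tuples. *)

(* Defs.v *)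
From mathcomp Require Import all_boot all_order all_algebra.
From mathcomp Require Import all_classical all_reals all_analysis.

Set Implicit Arguments.
Unset Strict Implicit.
Unset Printing Implicit Defensive.

(* The entries of a tableau range over {1, ..., m * n}; using 'I_(m * n).+1 as
   the entry type makes the set of tableaux a {set _} over a finType, the value
   0 being excluded by the first condition. Rows and columns are indexed from
   0. *)
Definition rect_tableaux (m n : nat) : {set 'M['I_(m * n).+1]_(m, n)} :=
  [set X : 'M['I_(m * n).+1]_(m, n) |
    [&& [set X ij.1 ij.2 | ij : 'I_m * 'I_n]%SET
          == [set v : 'I_(m * n).+1 | 0 < v]%SET,
        [forall i : 'I_m, forall j : 'I_n, forall j' : 'I_n,
           (j' == j.+1 :> nat) ==> (X i j < X i j')]
      & [forall i : 'I_m, forall j : 'I_n, forall i' : 'I_m,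
           (i' == i.+1 :> nat) ==> (X i j < X i' j)]]]%SET.

Local Open Scope classical_set_scope.
Local Open Scope ring_scope.

(* The finite type U carries the discrete sigma-algebra, which is what the
   second condition refers to. *)
Definition uniform_rv (d : measure_display) (T : measurableType d)
    (R : realType) (P : probability T R) (U : finType) (A : {set U})
    (X : T -> U) : Prop :=
  [/\ forall w : T, X w \in A,
      forall B : set U, measurable (X @^-1` B)
    & forall u : U, u \in A -> P (X @^-1` [set u]) = (#|A|%:R^-1)%:E].

(* Main.v *)
(** Reading the entries 1, 2, ..., mn of a tableau one after the other and
    recording their rows turns tableaux into ballot words. A tableau with
    X_{1,n} = k is then a path from the empty shape to a shape lambda with
    k - 1 cells and first row n - 1, followed by a path from lambda plus a
    corner in the first row to the full rectangle. Both numbers of paths are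
    factorials times determinants of inverse factorials. In the variables
    l_i = lambda_i + m - i (i >= 2), with L = m + n - 2, the product of the two
    determinants is a constant times the Krawtchouk weight
      prod_i 1 / (l_i! (L - 1 - l_i)!) * prod_(i < j) (l_i - l_j)^2,
    and by Andreief's identity its generating function with respect to
    sum_i l_i is a constant times X^b (1 + X)^((m - 1)(n - 1)). Hence the number
    of tableaux with X_{1,n} = k is, up to a constant independent of k,
      (k - 1)! (mn - k)! C((m - 1)(n - 1), k - n),
    which is proportional to C(k - 1, n - 1) C(mn - k, m - 1). Summing over k
    gives the constant. *)
Require Import Defs.
From mathcomp Require Import all_boot all_order all_fingroup all_algebra.
From mathcomp Require Import zify ring lra.
From mathcomp Require Import all_classical all_reals all_analysis.

Set Implicit Arguments.
Unset Strict Implicit.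
Unset Printing Implicit Defensive.
Import Order.TTheory GRing.Theory Num.Theory.

Local Open Scope ring_scope.

(** * Determinants of inverse factorials *)

(** The function 1/z!, extended by zero to negative integers like 1/Gamma(z + 1), so that
    [invfact_pred] holds for every integer. *)
Definition invfact (z : int) : rat := if z is Posz k then k`!%:R^-1 else 0.

Lemma invfact_lt0 z : z < 0 -> invfact z = 0.
Proof. by case: z. Qed.

Lemma invfact_pred z : invfact (z - 1) = z%:~R * invfact z.
Proof.
case: z => [[|k]|k]; first by rewrite mul0r.
- have -> : Posz k.+1 - 1 = Posz k by lia.
  by rewrite /invfact factS natrM invfM mulrA mulfV ?mul1r // pnatr_eq0.
- by rewrite mulr0 invfact_lt0.
Qed.

(** Expansion along the replaced column j uses only cofactors of [A], which form row j of
    [\adj A]. *)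
Lemma sum_det_col_replace (R : comPzRingType) m (A B : 'M[R]_m) :
  \sum_j \det (\matrix_(i, j') (if j' == j then B i j' else A i j')) =
  \tr (\adj A *m B).
Proof.
rewrite /mxtrace; apply: eq_bigr => j _.
rewrite (expand_det_col _ j) mxE; apply: eq_bigr => i _.
rewrite !mxE eqxx mulrC; congr (_ * _); rewrite /cofactor; congr (_ * _).
congr (\det _); apply/matrixP => i' j'; rewrite !mxE.
by rewrite eq_sym (negPf (neq_lift _ _)).
Qed.

(** A permutation avoiding the zero block would map the rows of index at least [i] injectively into
    the columns of index above [i], of which there is one fewer. *)
Lemma det_zero_block (R : comPzRingType) m (A : 'M[R]_m) (i : 'I_m) :
  (forall r c : 'I_m, (i <= r)%N -> (c <= i)%N -> A r c = 0) -> \det A = 0.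
Proof.
move=> A0; rewrite /determinant big1 // => s _.
case: (pickP (fun r : 'I_m => (i <= r)%N && (s r <= i)%N)) => [r /andP[ir si]|no].
  by rewrite (bigD1 r) //= A0 // mul0r mulr0.
pose S := [set r : 'I_m | (i <= r)%N].
have sub : s @: S \subset S :\ i.
  apply/fintype.subsetP => _ /imsetP[r Sr ->]; have ir : (i <= r)%N by rewrite inE in Sr.
  have := no r; rewrite ir /= => /negbT; rewrite -ltnNge => si.
  by rewrite !inE ltnW // andbT; apply: contraTneq si => ->; rewrite ltnn.
have := subset_leq_card sub; rewrite card_imset; last exact: perm_inj.
by rewrite (cardsD1 i S) inE leqnn ltnn.
Qed.

Definition invfact_mx m (a b : 'I_m -> int) : 'M[rat]_m :=
  \matrix_(i, j) invfact (a i - b j).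

(** With D_a and D_b the diagonal matrices of a and b, both sides are the trace of
    adj A * (D_a A - A D_b). *)
Lemma det_invfact_rec m (a b : 'I_m -> int) :
  (\sum_i a i - \sum_i b i)%:~R * \det (invfact_mx a b) =
  \sum_i \det (invfact_mx a (fun j => b j + (j == i)%:R)).
Proof.
pose D (c : 'I_m -> int) : 'M[rat]_m := diag_mx (\row_i (c i)%:~R).
set A := invfact_mx a b.
transitivity (\tr (\adj A *m (D a *m A - A *m D b))).
  have trD c : \tr (D c) = (\sum_i c i)%:~R.
    by rewrite mxtrace_diag rmorph_sum; apply: eq_bigr => i _; rewrite mxE.
  rewrite mulmxBr [RHS]raddfB /= mulmxA mxtrace_mulC mulmxA mul_mx_adj mulmxA.
  by rewrite mul_adj_mx !mul_scalar_mx !mxtraceZ !trD rmorphB mulrBl mulrC [X in _ - X]mulrC.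
rewrite -sum_det_col_replace; apply: eq_bigr => j _; congr (\det _).
rewrite /D mul_diag_mx mul_mx_diag; apply/matrixP => i j'; rewrite !mxE.
case: (eqVneq j' j) => [->|_]; last by rewrite addr0.
have -> : a i - (b j + true%:R) = a i - b j - 1 by lia.
rewrite invfact_pred rmorphB /=; ring.
Qed.

(** * Ballot words *)

Lemma sum_tuple0 (V : nmodType) (I : finType) (F : seq I -> V) :
  \sum_(w : 0.-tuple I) F w = F [::].
Proof.
rewrite (big_pred1 [tuple]) //= => w; symmetry; apply/eqP.
by rewrite tuple0.
Qed.

Lemma sum_tupleS (V : nmodType) (I : finType) t (F : seq I -> V) :
  \sum_(w : t.+1.-tuple I) F w = \sum_i \sum_(w : t.-tuple I) F (i :: w).
Proof.
rewrite pair_big /=.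
rewrite (reindex (fun x : I * t.-tuple I => [tuple of x.1 :: x.2])) //=.
exists (fun w : t.+1.-tuple I => (thead w, [tuple of behead w])) => [[i w] _|w _] /=.
  by congr (_, _); apply: val_inj.
by rewrite [RHS]tuple_eta.
Qed.

Lemma sum_tuple_cat (V : nmodType) (I : finType) t t' (F : seq I -> V) :
  \sum_(w : (t + t').-tuple I) F w =
  \sum_(u : t.-tuple I) \sum_(v : t'.-tuple I) F (u ++ v).
Proof.
elim: t F => [|t IHt] F.
  by rewrite (sum_tuple0 (fun u => \sum_(v : t'.-tuple I) F (u ++ v))).
rewrite (sum_tupleS (t + t')%N F).
rewrite (sum_tupleS _ (fun u => \sum_(v : t'.-tuple I) F (u ++ v))).
by apply: eq_bigr => i _; rewrite (IHt (fun w => F (i :: w))).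
Qed.

Section Ballot.
Variable m : nat.
Implicit Types (s : {ffun 'I_m -> nat}) (w : seq 'I_m).

Definition dominant s :=
  [forall i : 'I_m, forall j : 'I_m, (i <= j)%N ==> (s j <= s i)%N].

Definition incr s (i : 'I_m) : {ffun 'I_m -> nat} :=
  [ffun j => (s j + (j == i))%N].

Fixpoint ballot s w :=
  dominant s && (if w is i :: w' then ballot (incr s i) w' else true).

Definition num_ballot t s s' : rat :=
  \sum_(w : t.-tuple 'I_m) (ballot s w && (foldl incr s w == s'))%:R.

Lemma dominantP s :
  reflect (forall i j : 'I_m, (i <= j)%N -> (s j <= s i)%N) (dominant s).
Proof.
apply: (iffP forallP) => [H i j ij|H i].
  by move/forallP/(_ j)/implyP: (H i); apply.
by apply/forallP => j; apply/implyP; apply: H.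
Qed.

Lemma ballot_dominant s w : ballot s w -> dominant s.
Proof. by case: w => [|i w] /andP[]. Qed.

Lemma ballot_cat s u v : ballot s (u ++ v) = ballot s u && ballot (foldl incr s u) v.
Proof.
elim: u s => [|i u IHu] s /=; last by rewrite IHu andbA.
by rewrite andbT andb_idl //; apply: ballot_dominant.
Qed.

Lemma sum_incr s i : (\sum_j incr s i j = (\sum_j s j).+1)%N.
Proof.
rewrite (eq_bigr (fun j => s j + (j == i))%N); last by move=> j _; rewrite ffunE.
rewrite big_split /= -addn1; congr addn.
by rewrite (bigD1 i) //= eqxx big1 // => j /negPf->.
Qed.

Lemma num_ballotS t s s' : dominant s ->
  num_ballot t.+1 s s' = \sum_i num_ballot t (incr s i) s'.
Proof.
move=> doms; rewrite /num_ballot.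
rewrite (sum_tupleS _ (fun w => (ballot s w && (foldl incr s w == s'))%:R)).
by apply: eq_bigr => i _; apply: eq_bigr => w _; rewrite /= doms.
Qed.

Lemma num_ballot_not_dominant t s s' : ~~ dominant s -> num_ballot t s s' = 0.
Proof.
move=> ndom; apply: big1 => w _.
by case: (boolP (ballot s w)) => // /ballot_dominant; rewrite (negPf ndom).
Qed.

Definition shifted s (i : 'I_m) : int := (s i)%:Z - i%:Z.

(** Aitken's determinant for standard tableaux of skew shape s' / s. A first letter
    leading to a shape that is not dominant contributes a determinant with two
    equal columns. *)
Lemma num_ballotE t s s' : dominant s -> dominant s' ->
  (\sum_i s' i = \sum_i s i + t)%N ->
  num_ballot t s s' = t`!%:R * \det (invfact_mx (shifted s') (shifted s)).
Proof.
move=> + doms'; elim: t s => [|t IHt] s doms sums.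
  rewrite /num_ballot (sum_tuple0 (fun w => (ballot s w && (foldl incr s w == s'))%:R)).
  rewrite /= doms andbT mul1r; case: eqVneq => [<-|neq] /=.
    rewrite -det_tr det_trig; last first.
      apply/is_trig_mxP => i j ij; rewrite !mxE invfact_lt0 //.
      by have /dominantP/(_ i j (ltnW ij)) := doms; rewrite /shifted; lia.
    by rewrite big1 // => i _; rewrite !mxE subrr /= invr1.
  (* Otherwise [s] would lie inside [s'], and equal sizes would force equality. Such a row gives a
     zero block. *)
  have [i s'i] : exists i, (s' i < s i)%N.
    apply/existsP; apply: contraR neq; rewrite negb_exists => /forallP le.
    have {}le j : (s j <= s' j)%N by rewrite leqNgt.
    apply/eqP/ffunP => i; apply/eqP; rewrite eqn_leq le /=.
    have := sums; rewrite addn0 (bigD1 i) //= [in RHS](bigD1 i) //= => eq_sums.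
    rewrite -(leq_add2r (\sum_(j < m | j != i) s j)%N) -eq_sums leq_add2l.
    by apply: leq_sum => j _.
  rewrite (@det_zero_block _ _ _ i) // => r c ir ci; rewrite mxE invfact_lt0 //.
  have /dominantP/(_ _ _ ir) := doms'; have /dominantP/(_ _ _ ci) := doms.
  by rewrite /shifted; lia.
rewrite num_ballotS //.
have step i : num_ballot t (incr s i) s' =
    t`!%:R * \det (invfact_mx (shifted s') (fun j => shifted s j + (j == i)%:R)).
  have eqb : invfact_mx (shifted s') (fun j => shifted s j + (j == i)%:R) =
      invfact_mx (shifted s') (shifted (incr s i)).
    apply/matrixP => r c; rewrite !mxE /shifted ffunE; congr invfact; case: eqP; lia.
  rewrite eqb; case: (boolP (dominant (incr s i))) => [dom|ndom].
    by apply: IHt; rewrite // sum_incr sums; lia.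
  rewrite num_ballot_not_dominant // -det_tr.
  (* A new cell in row i can break dominance only against the row just above, of the same length;
     then [shifted] takes equal values at i and j. *)
  have [j ji sj] : exists2 j : 'I_m, j.+1 = i :> nat & s j = s i.
    have /dominantP domP := doms.
    move: ndom; rewrite /dominant negb_forall => /existsP[a].
    rewrite negb_forall => /existsP[b]; rewrite negb_imply -ltnNge !ffunE => /andP[ab].
    have := domP _ _ ab.
    case: (eqVneq b i) ab => [-> ai|_ _]; last by lia.
    have [->|ai'] := eqVneq a i; first by lia.
    have {}ai : (a < i)%N by rewrite ltn_neqAle ai ai'.
    have jm : (i.-1 < m)%N by have := ltn_ord i; lia.
    exists (Ordinal jm) => /=; first by lia.
    have := domP a (Ordinal jm); have := domP (Ordinal jm) i.
    by rewrite /=; lia.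
  rewrite (@determinant_alternate _ _ _ i j) ?mulr0 //.
    by apply/eqP => ij; move: ji; rewrite ij; lia.
  move=> r; rewrite !mxE /shifted !ffunE eqxx; congr invfact.
  by case: eqP => [ij|_]; [move: ji; rewrite ij|]; lia.
under eq_bigr => i _ do rewrite step.
rewrite -mulr_sumr -det_invfact_rec.
have -> : \sum_i shifted s' i - \sum_i shifted s i = Posz t.+1.
  rewrite -sumrB (eq_bigr (fun i => Posz (s' i) - Posz (s i))); last first.
    by move=> i _; rewrite /shifted; lia.
  rewrite sumrB -!(big_morph Posz PoszD (erefl _)) sums PoszD addrAC subrr add0r.
  by [].
by rewrite factS natrM mulrCA mulrA.
Qed.
End Ballot.

Local Open Scope nat_scope.

(** * Reading words of tableaux *)

Lemma foldl_incrE m (s : {ffun 'I_m -> nat}) (w : seq 'I_m) i :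
  foldl (@incr m) s w i = s i + count_mem i w.
Proof.
elim: w s => [|j w IHw] s /=; first by rewrite addn0.
by rewrite IHw ffunE addnA [j == i]eq_sym.
Qed.

Lemma ballotP m (s : {ffun 'I_m -> nat}) (w : seq 'I_m) :
  reflect (forall t, dominant (foldl (@incr m) s (take t w))) (ballot s w).
Proof.
apply: (iffP idP) => [bw t|].
  have := bw; rewrite -[w in X in X -> _](cat_take_drop t) ballot_cat.
  by case/andP => _ /ballot_dominant.
elim: w s => [|i w IHw] s dom /=; first by rewrite (dom 0).
by rewrite (dom 0) IHw // => t; apply: dom t.+1.
Qed.

Lemma card_ord_lt n c : c <= n -> #|[set j : 'I_n | j < c]| = c.
Proof.
move=> cn; rewrite -sum1_card (eq_bigl (fun j : 'I_n => j < c)) => [|j]; last by rewrite inE.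
by rewrite -(big_ord_widen n (fun=> 1)) // sum1_card card_ord.
Qed.

Section TableauxWords.
Variables m n : nat.
Local Notation N := (m * n).
Local Notation tableau := 'M['I_N.+1]_(m, n).

Definition empty_shape : {ffun 'I_m -> nat} := [ffun=> 0].
Definition full_shape : {ffun 'I_m -> nat} := [ffun=> n].

Definition lattice_word (w : seq 'I_m) :=
  ballot empty_shape w && (foldl (@incr m) empty_shape w == full_shape).

Lemma lattice_wordP (w : seq 'I_m) :
  reflect ((forall t (i i' : 'I_m), i <= i' ->
              count_mem i' (take t w) <= count_mem i (take t w)) /\
           forall i, count_mem i w = n)
    (lattice_word w).
Proof.
apply: (iffP andP) => [[/ballotP bw /eqP fw]|[bw fw]]; split.
- move=> t i i' le; have /dominantP/(_ _ _ le) := bw t.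
  by rewrite !foldl_incrE !ffunE.
- by move=> i; have := congr1 (fun s => fun_of_fin s i) fw; rewrite foldl_incrE !ffunE.
- apply/ballotP => t; apply/dominantP => i i' le.
  by rewrite !foldl_incrE !ffunE; apply: bw.
- by apply/eqP/ffunP => i; rewrite foldl_incrE !ffunE fw.
Qed.

(** The letter of w at position t (counted from 0) is the row of the entry t + 1
    of X. *)
Definition reading_word (X : tableau) (w : seq 'I_m) :=
  forall (i : 'I_m) (j : 'I_n) t, (X i j <= t) = (j < count_mem i (take t w)).

Lemma count_takeS (w : seq 'I_m) i t : t < size w ->
  count_mem i (take t.+1 w) = count_mem i (take t w) + (nth i w t == i).
Proof. by move=> tw; rewrite (take_nth i) // -cats1 count_cat /= addn0. Qed.

Lemma leq_count_take (w : seq 'I_m) i t t' : t <= t' ->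
  count_mem i (take t w) <= count_mem i (take t' w).
Proof.
by move=> tt'; rewrite -(take_takel _ tt') -[Y in _ <= count_mem _ Y](cat_take_drop t) count_cat leq_addr.
Qed.

(** The bound [X i j <= t] first holds at t + 1 exactly when the letter at position t is the (j +
    1)-st letter i. *)
Lemma reading_word_cell X w (i : 'I_m) (j : 'I_n) t : reading_word X w -> t < size w ->
  (X i j == t.+1 :> nat) = (nth i w t == i) && (count_mem i (take t w) == j).
Proof.
move=> rXw tw; rewrite eqn_leq ltnNge !rXw count_takeS //.
by case: eqP => _; lia.
Qed.

(** The inverse of reading: a cell receives the length of the shortest prefix that fills it. *)
Definition tableau_of_word (w : seq 'I_m) : tableau :=
  \matrix_(i, j) inord (find (fun t => j < count_mem i (take t w)) (iota 0 N.+1)).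

Lemma reading_word_tableau_of_word (w : N.-tuple 'I_m) :
  lattice_word w -> reading_word (tableau_of_word w) w.
Proof.
case/lattice_wordP => _ fw i j t; rewrite mxE.
set P := fun t => _; have hasP : has P (iota 0 N.+1).
  apply/hasP; exists N; first by rewrite mem_iota ltnSn.
  by rewrite /P -{1}(size_tuple w) take_size fw.
have := hasP; rewrite has_find size_iota => ltf; rewrite inordK //.
apply/idP/idP => [le|Pt].
  apply: leq_trans (leq_count_take _ _ le).
  by have := nth_find 0 hasP; rewrite nth_iota.
rewrite leqNgt; apply/negP => lt; have := before_find 0 lt.
by rewrite nth_iota ?add0n; [rewrite /P Pt | apply: ltn_trans ltf].
Qed.

Lemma reading_word_inj_tableau X X' w : reading_word X w -> reading_word X' w -> X = X'.
Proof.
move=> rX rX'; apply/matrixP => i j; apply/val_inj/eqP.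
by rewrite eqn_leq /= rX -rX' leqnn rX' -rX leqnn.
Qed.

Lemma lattice_word_letter (w : N.-tuple 'I_m) t : lattice_word w -> t < N ->
  exists i (j : 'I_n), nth i w t == i /\ count_mem i (take t w) = j.
Proof.
move=> /lattice_wordP[_ fw] tN; have tw : t < size w by rewrite size_tuple.
have m0 : 0 < m by case: (m) tN.
pose i := nth (Ordinal m0) w t.
have wt : nth i w t == i by rewrite (set_nth_default (Ordinal m0)).
have lt : count_mem i (take t w) < n.
  have := leq_count_take w i tw.
  by rewrite take_size fw count_takeS // wt addn1.
by exists i, (Ordinal lt).
Qed.

Lemma reading_word_inj X (w w' : N.-tuple 'I_m) : lattice_word w ->
  reading_word X w -> reading_word X w' -> w = w'.
Proof.
move=> lw rw rw'; apply: val_inj; have [m0|m_gt0] := posnP m.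
  have nil (v : N.-tuple 'I_m) : val v = [::] by apply: size0nil; rewrite size_tuple m0.
  by rewrite !nil.
apply: (@eq_from_nth _ (Ordinal m_gt0)); rewrite !size_tuple // => t tN.
have [i [j [wt ct]]] := lattice_word_letter lw tN.
have : X i j == t.+1 :> nat by rewrite (reading_word_cell _ _ rw) ?size_tuple // wt ct eqxx.
rewrite (reading_word_cell _ _ rw') ?size_tuple // => /andP[/eqP w't _].
rewrite (set_nth_default i) ?size_tuple // (eqP wt).
by rewrite (set_nth_default i) ?size_tuple.
Qed.

(** Every value occurs because each position of the word fills a cell; rows increase because cells
    of a row are filled in order, columns because of the ballot condition. *)
Lemma tableau_of_wordP (w : N.-tuple 'I_m) : lattice_word w ->
  tableau_of_word w \in rect_tableaux m n.
Proof.
move=> lw; have rw := reading_word_tableau_of_word lw.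
have [bw fw] := lattice_wordP _ lw.
set X := tableau_of_word w in rw *.
have X_gt0 i j : 0 < X i j by rewrite ltnNge rw take0.
have cell i j : exists2 t, t < N & X i j = t.+1 :> nat.
  exists (X i j).-1; last by rewrite prednK.
  by rewrite -ltnS prednK // ltn_ord.
rewrite inE; apply/and3P; split.
- apply/eqP/setP => v; rewrite inE; apply/imsetP/idP => [[[i j] _ ->] //|v0].
  have vN : v.-1 < N by rewrite -ltnS prednK // ltn_ord.
  have [i [j [wt ct]]] := lattice_word_letter lw vN.
  exists (i, j) => //; apply/val_inj/eqP; rewrite eq_sym /= -(prednK v0).
  by rewrite (reading_word_cell _ _ rw) ?size_tuple // wt ct eqxx.
- apply/forallP => i; apply/forallP => j; apply/forallP => j'.
  apply/implyP => /eqP j'E; have [t tN Xt] := cell i j; rewrite Xt.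
  have := eqxx (X i j : nat); rewrite {2}Xt (reading_word_cell _ _ rw) ?size_tuple //.
  case/andP => wt /eqP ct.
  by rewrite ltnNge rw count_takeS ?size_tuple // wt ct j'E; lia.
- apply/forallP => i; apply/forallP => j; apply/forallP => i'.
  apply/implyP => /eqP i'E; have [t tN Xt] := cell i j; rewrite Xt.
  have := eqxx (X i j : nat); rewrite {2}Xt (reading_word_cell _ _ rw) ?size_tuple //.
  case/andP => wt /eqP ct.
  rewrite ltnNge rw count_takeS ?size_tuple //.
  have -> : (nth i' w t == i') = false.
    rewrite (set_nth_default i) ?size_tuple // (eqP wt).
    by apply/eqP => ii'; move: i'E; rewrite ii'; lia.
  by rewrite addn0 -leqNgt -ct bw // i'E.
Qed.

Lemma tableau_reading_word (m_gt0 : 0 < m) (X : tableau) : X \in rect_tableaux m n ->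
  exists2 w : N.-tuple 'I_m, lattice_word w & reading_word X w.
Proof.
rewrite inE => /and3P[/eqP imX /forallP rowX /forallP colX].
(* There are as many values as cells. *)
have Xinj : injective (fun ij : 'I_m * 'I_n => X ij.1 ij.2).
  have /imset_injP inj : #|[set X ij.1 ij.2 | ij : 'I_m * 'I_n]| == #|{: 'I_m * 'I_n}|.
    have pos : [set v : 'I_N.+1 | 0 < v] = [set~ ord0].
      by apply/setP => v; rewrite !inE -val_eqE lt0n.
    by rewrite imX pos cardsC1 card_prod !card_ord.
  by move=> a b; apply: inj.
have X_gt0 i j : 0 < X i j.
  have : X i j \in [set X ij.1 ij.2 | ij : 'I_m * 'I_n] by apply/imsetP; exists (i, j).
  by rewrite imX inE.
have Xsurj t : t < N -> exists i j, X i j = t.+1 :> nat.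
  move=> tN; have : inord t.+1 \in [set v : 'I_N.+1 | 0 < v] by rewrite inE inordK.
  by rewrite -imX => /imsetP[[i j] _ /(congr1 val)]; rewrite /= inordK // => ->; exists i, j.
have rowX' i (j j' : 'I_n) : j < j' -> X i j < X i j'.
  case: j' => j' j'n /=; elim: j' j'n => // j' IHj j'n; rewrite ltnS leq_eqVlt => jj'.
  have j'n' := ltnW j'n.
  have step : X i (Ordinal j'n') < X i (Ordinal j'n).
    by have /forallP/(_ (Ordinal j'n'))/forallP/(_ (Ordinal j'n))/implyP := rowX i; apply.
  case/orP: jj' => [/eqP jj'|jj']; last exact: ltn_trans (IHj j'n' jj') step.
  by have -> : j = Ordinal j'n' by apply: val_inj.
have colX' (i i' : 'I_m) j : i <= i' -> X i j <= X i' j.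
  case: i' => i' i'm /=; elim: i' i'm => [|i' IHi] i'm.
    by rewrite leqn0 => /eqP i0; have -> : i = Ordinal i'm by apply: val_inj.
  rewrite leq_eqVlt => /orP[/eqP ii'|].
    by have -> : i = Ordinal i'm by apply: val_inj.
  have i'm' := ltnW i'm; rewrite ltnS => /(IHi i'm') le.
  apply: leq_trans le (ltnW _).
  by have /forallP/(_ j)/forallP/(_ (Ordinal i'm))/implyP := colX (Ordinal i'm'); apply.
(* The row of the entry t + 1; by [Xsurj] the default is not reached for t < N. *)
pose row_of t := odflt (Ordinal m_gt0) [pick i | [exists j, X i j == t.+1 :> nat]].
have row_ofP t i j : X i j = t.+1 :> nat -> row_of t = i.
  rewrite /row_of; case: pickP => [i' /existsP[j' /eqP Xi'] /= Xi|/(_ i)/existsP no Xi].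
    by have /(Xinj (i', j') (i, j)) [] : X i' j' = X i j by apply: val_inj; rewrite /= Xi Xi'.
  by case: no; exists j; apply/eqP.
pose w := [tuple row_of t | t < N].
have wE i t : t < N -> nth i w t = row_of t.
  by move=> tN; rewrite -[t]/(val (Ordinal tN)) nth_mktuple.
(* Letters i in the prefix of length t correspond to entries at most t in row i; since rows
   increase, these fill an initial segment of the row. *)
have countE i t : t <= N -> count_mem i (take t w) = #|[set j | X i j <= t]|.
  elim: t => [_|t IHt tN].
    rewrite take0 /=; symmetry; apply: eq_card0 => j.
    by rewrite !inE leqNgt X_gt0.
  rewrite count_takeS ?size_tuple // wE // IHt ?(ltnW tN) //.
  have [i' [j' Xt]] := Xsurj t tN; rewrite (row_ofP t i' j' Xt).
  case: eqVneq => [<-|neq] /=.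
    have j't : j' \notin [set j | X i' j <= t] by rewrite inE Xt ltnn.
    rewrite addnC; have := cardsU1 j' [set j | X i' j <= t]; rewrite j't => <-.
    apply: eq_card => j; rewrite !inE [RHS]leq_eqVlt ltnS; congr orb.
    apply/eqP/eqP => [->//|Xj].
    by have /(Xinj (i', j) (i', j')) [] : X i' j = X i' j' by apply: val_inj; rewrite /= Xj Xt.
  rewrite addn0; apply: eq_card => j; rewrite !inE [RHS]leq_eqVlt ltnS.
  case: eqP => //= Xj; case/eqP: neq.
  by have /(Xinj (i', j') (i, j)) [] : X i' j' = X i j by apply: val_inj; rewrite /= Xj Xt.
have rw : reading_word X w.
  move=> i j t; wlog tN : t / t <= N => [IH|].
    have [/IH//|Nt] := leqP t N; have := IH N (leqnn _).
    rewrite !take_oversize ?size_tuple ?(ltnW Nt) // => <-.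
    by rewrite -(ltnS _ N) ltn_ord (leq_trans _ (ltnW Nt)) // -ltnS.
  rewrite countE //; apply/idP/idP => [le|].
    rewrite -(card_ord_lt (ltn_ord j)); apply/subset_leq_card/fintype.subsetP => j'.
    rewrite !inE ltnS leq_eqVlt => /orP[/eqP jj'|jj'].
      by have -> : j' = j by apply: val_inj.
    exact: leq_trans (ltnW (rowX' _ _ _ jj')) le.
  apply: contraTT; rewrite -ltnNge -leqNgt => lt.
  rewrite -(card_ord_lt (ltnW (ltn_ord j))); apply/subset_leq_card/fintype.subsetP => j'.
  rewrite !inE => le; rewrite ltnNge leq_eqVlt; apply/negP => /orP[/eqP jj'|/rowX' jj'].
    by have e : j = j' by [apply: val_inj]; move: lt; rewrite e ltnNge le.
  by have := leq_trans (jj' i) le; rewrite ltnNge ltnW.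
have cntn i : count_mem i w = n.
  rewrite -{1}(take_oversize (s := w) (n := N)) ?size_tuple // countE //.
  by rewrite -[RHS]card_ord; apply: eq_card => j; rewrite !inE -ltnS ltn_ord.
exists w => //; apply/lattice_wordP; split=> // t i i' ii'.
(* A violation at t would give a cell in row i' with entry at most t, below a cell in row i with
   entry above t. *)
rewrite leqNgt; apply/negP => lt.
have ltn : count_mem i (take t w) < n.
  have le : count_mem i' (take t w) <= count_mem i' w.
    by rewrite -[Y in _ <= count_mem _ Y](cat_take_drop t) count_cat leq_addr.
  by rewrite cntn in le; apply: leq_trans lt le.
have := rw i' (Ordinal ltn) t; rewrite /= lt => Xt.
have := rw i (Ordinal ltn) t; rewrite /= ltnn => /negbT/negP; apply.
exact: leq_trans (colX' _ _ _ ii') Xt.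
Qed.
End TableauxWords.

Local Open Scope ring_scope.

(** * Andreief's identity *)

Definition comp_perm p (T : Type) (l : {ffun 'I_p -> T}) (s : 'S_p) : {ffun 'I_p -> T} :=
  [ffun i => l (s i)].

Lemma reindex_comp_perm (V : nmodType) p (T : finType) (s : 'S_p)
    (F : {ffun 'I_p -> T} -> V) :
  \sum_l F l = \sum_l F (comp_perm l s).
Proof.
apply: reindex; exists (fun l => comp_perm l s^-1%g) => l _;
  by apply/ffunP => i; rewrite !ffunE (permK, permKV).
Qed.

Lemma det_comp_perm (R : comPzRingType) p (T : Type) (A : T -> 'I_p -> R)
    (l : {ffun 'I_p -> T}) (s : 'S_p) :
  \det (\matrix_(i, j) A (comp_perm l s i) j) =
  (-1) ^+ s * \det (\matrix_(i, j) A (l i) j).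
Proof.
rewrite -det_perm -det_mulmx -row_permE; congr (\det _).
by apply/matrixP => i j; rewrite !mxE ffunE.
Qed.

(** After expanding the determinant of [B] and permuting [l], the signs cancel and all p!
    permutations give the same sum. Expanding the determinant of [A] then turns the sum over [l]
    into a product of sums. *)
Lemma andreief (R : comPzRingType) p (T : finType) (A B : T -> 'I_p -> R) :
  \sum_(l : {ffun 'I_p -> T})
    \det (\matrix_(i, j) A (l i) j) * \det (\matrix_(i, j) B (l i) j) =
  p`!%:R * \det (\matrix_(i, j) \sum_t B t i * A t j).
Proof.
transitivity (\sum_(s : 'S_p) \sum_(l : {ffun 'I_p -> T})
    \det (\matrix_(i, j) A (l i) j) * \prod_i B (l i) i).
  under eq_bigr => l _ do rewrite [X in _ * X]/determinant mulr_sumr.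
  rewrite exchange_big; apply: eq_bigr => s _ /=.
  rewrite [RHS](reindex_comp_perm s^-1); apply: eq_bigr => l _.
  rewrite det_comp_perm odd_permV mulrCA -mulrA; congr (_ * (_ * _)).
  rewrite [RHS](reindex_inj (@perm_inj _ s)) /=.
  by apply: eq_bigr => i _; rewrite mxE ffunE permK.
rewrite sumr_const card_Sn -[LHS]mulr_natl; congr (_ * _).
rewrite /determinant.
under eq_bigr => l _ do rewrite mulr_suml.
rewrite exchange_big; apply: eq_bigr => s _ /=.
under [in RHS]eq_bigr => i _ do rewrite mxE.
rewrite bigA_distr_bigA mulr_sumr; apply: eq_bigr => l _.
rewrite -mulrA; congr (_ * _); rewrite -big_split; apply: eq_bigr => i _.
by rewrite mxE mulrC.
Qed.

Definition decreasing p M (l : {ffun 'I_p -> 'I_M}) :=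
  [forall i : 'I_p, forall j : 'I_p, (i < j)%N ==> (l j < l i)%N].

Lemma decreasingP p M (l : {ffun 'I_p -> 'I_M}) :
  reflect (forall i j : 'I_p, (i < j)%N -> (l j < l i)%N) (decreasing l).
Proof.
apply: (iffP forallP) => [H i j ij|H i].
  by move/forallP/(_ j)/implyP: (H i); apply.
by apply/forallP => j; apply/implyP; apply: H.
Qed.

(** Sorting gives existence. A strictly decreasing sequence is determined by its set of values, so
    injectivity of [l] gives uniqueness. *)
Lemma card_sorting_perm p M (l : {ffun 'I_p -> 'I_M}) : injective l ->
  #|[set s : 'S_p | decreasing (comp_perm l s)]| = 1%N.
Proof.
move=> l_inj; pose gt (x y : 'I_M) := (y < x)%N.
have gt_trans : transitive gt by move=> y x z xy yz; apply: ltn_trans yz xy.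
have decr_sorted (f : {ffun 'I_p -> 'I_M}) : decreasing f = sorted gt (mktuple f).
  apply/decreasingP/idP => [decr|srt i j ij].
    rewrite (_ : val (mktuple f) = map f (enum 'I_p)) // sorted_map.
    have : sorted ltn (map val (enum 'I_p)) by rewrite val_enum_ord iota_ltn_sorted.
    by rewrite sorted_map; apply: sub_sorted => i j; apply: decr.
  have := sorted_ltn_nth gt_trans (f i) srt; move/(_ i j).
  rewrite !inE size_tuple !ltn_ord => /(_ isT isT ij).
  by rewrite /gt !nth_mktuple.
pose t := [tuple l i | i < p].
have uniq_t : uniq t by rewrite map_inj_uniq ?enum_uniq.
have : perm_eq (sort (relpre val geq) t) t by rewrite perm_sort.
case/tuple_permP => s ts; apply/eqP/cards1P; exists s; apply/setP => s'.
have sE (s0 : 'S_p) : val (mktuple (comp_perm l s0)) = map l [seq s0 i | i <- enum 'I_p].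
  by rewrite -map_comp; apply: eq_map => i; rewrite /= ffunE.
have decr_s : sorted gt (mktuple (comp_perm l s)).
  have -> : val (mktuple (comp_perm l s)) = sort (relpre val geq) t.
    by rewrite ts; apply: eq_map => i; rewrite ffunE tnth_mktuple.
  have : sorted (relpre val geq) (sort (relpre val geq) t).
    by apply: sort_sorted => x y; rewrite /= leq_total.
  have : uniq (sort (relpre val geq) t) by rewrite sort_uniq.
  elim: (sort _ _) => //= x [//|y s1] IHs /andP[xs us] /andP[xy ys].
  have {}xy : (y <= x)%N := xy.
  rewrite /=; apply/andP; split; last exact: IHs.
  rewrite /gt ltn_neqAle xy andbT.
  by move: xs; rewrite inE negb_or eq_sym => /andP[].
rewrite !inE decr_sorted; apply/idP/eqP => [srt|-> //].
apply/permP => i; apply: l_inj.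
have /(congr1 (fun r => nth (l i) r i)) : val (mktuple (comp_perm l s')) = mktuple (comp_perm l s).
  apply: (irr_sorted_eq gt_trans) => // [x|x]; first by rewrite /gt ltnn.
  rewrite !sE; apply: eq_mem_map => y.
  have all_in (s0 : 'S_p) : y \in [seq s0 i | i <- enum 'I_p].
    by rewrite -[y](permKV s0) map_f ?mem_enum.
  by rewrite !all_in.
by rewrite !nth_mktuple !ffunE.
Qed.

(** Sum over the pairs (s, l) with [comp_perm l s] decreasing: an injective [l] occurs with exactly
    one [s], the other [l] contribute zero. *)
Lemma sum_decreasing (V : nmodType) p M (F : {ffun 'I_p -> 'I_M} -> V) :
  (forall l s, F (comp_perm l s) = F l) ->
  (forall l : {ffun 'I_p -> 'I_M}, ~~ injectiveb l -> F l = 0) ->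
  \sum_l F l = (\sum_(l | decreasing l) F l) *+ p`!.
Proof.
move=> F_perm F_inj.
transitivity (\sum_(s : 'S_p) \sum_(l | decreasing (comp_perm l s)) F l); last first.
  rewrite -(card_Sn p) -sumr_const; apply: eq_bigr => s _.
  rewrite [LHS]big_mkcond [RHS]big_mkcond /= [RHS](reindex_comp_perm s).
  by apply: eq_bigr => l _; rewrite F_perm.
under [RHS]eq_bigr => s _ do rewrite big_mkcond /=.
rewrite [RHS]exchange_big /=; apply: eq_bigr => l _; rewrite -big_mkcond /= sumr_const.
case: (boolP (injectiveb l)) => [/injectiveP l_inj|l_ninj].
  by rewrite -cardsE card_sorting_perm.
by rewrite F_inj // mul0rn.
Qed.

(** * The Krawtchouk weight *)

Lemma det_scale_row_col (R : comPzRingType) p (f g : 'I_p -> R) (A : 'I_p -> 'I_p -> R) :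
  \det (\matrix_(i, j) (f i * A i j * g j)) =
  (\prod_i f i) * \det (\matrix_(i, j) A i j) * \prod_i g i.
Proof.
rewrite -[\prod_i f i](_ : \det (diag_mx (\row_i f i)) = _); last first.
  by rewrite det_diag; apply: eq_bigr => i _; rewrite mxE.
rewrite -[\prod_i g i](_ : \det (diag_mx (\row_i g i)) = _); last first.
  by rewrite det_diag; apply: eq_bigr => i _; rewrite mxE.
rewrite -!det_mulmx mul_diag_mx mul_mx_diag; congr (\det _).
by apply/matrixP => i j; rewrite !mxE.
Qed.

Lemma invfact_bin (D f : nat) :
  invfact (D%:Z - f%:Z) * invfact f%:Z = invfact D%:Z * 'C(D, f)%:R.
Proof.
have [fD|Df] := leqP f D; last first.
  by rewrite bin_small // invfact_lt0 ?mul0r ?mulr0 //; lia.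
have -> : D%:Z - f%:Z = (D - f)%N by lia.
have nz k : (0 < k)%N -> k%:R != 0 :> rat by rewrite pnatr_eq0 -lt0n.
rewrite /= -(bin_fact fD) !natrM; field.
by rewrite !nz ?fact_gt0 ?bin_gt0.
Qed.

Lemma coef_1addX_exp (R : comNzRingType) D e : ((1 + 'X : {poly R}) ^+ D)`_e = 'C(D, e)%:R.
Proof.
have -> : (1 + 'X : {poly R}) ^+ D = \poly_(i < D.+1) 'C(D, i)%:R.
  rewrite exprDn poly_def; apply: eq_bigr => i _.
  by rewrite expr1n mul1r scaler_nat.
by rewrite coef_poly ltnS; case: leqP => // De; rewrite bin_small.
Qed.

(** Binomial theorem: the coefficient of X^e is C(L - 1 - i - j, e - j) / (L - 1 - i - j)!. If L - 1
    - i - j is negative both sides vanish, so truncation in the exponent does no harm. *)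
Lemma sum_invfact_convolution (L i j : nat) :
  \sum_(t < L.+1) (invfact (L%:Z - 1 - t%:Z - i%:Z))%:P * ((invfact (t%:Z - j%:Z))%:P * 'X^t) =
  (invfact (L%:Z - 1 - i%:Z - j%:Z))%:P * 'X^j * (1 + 'X) ^+ (L - 1 - i - j).
Proof.
under eq_bigr => t _ do rewrite mulrA -polyCM mul_polyC.
rewrite -(poly_def L.+1 (fun t : nat =>
  invfact (L%:Z - 1 - t%:Z - i%:Z) * invfact (t%:Z - j%:Z))).
apply/polyP => e.
rewrite coef_poly -mulrA coefCM coefXnM coef_1addX_exp.
have [neg|] := ltrP (L%:Z - 1 - i%:Z - j%:Z) 0.
  rewrite (invfact_lt0 neg) mul0r; case: ltnP => // _.
  have [ej|je] := ltrP (e%:Z - j%:Z) 0; first by rewrite (invfact_lt0 ej) mulr0.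
  by rewrite invfact_lt0 ?mul0r //; lia.
move=> pos; case: (ltnP e j) => [ej|je].
  rewrite mulr0 [invfact (e%:Z - _)]invfact_lt0 ?mulr0 ?if_same //; lia.
case: (ltnP e L.+1) => [eL|Le]; last by rewrite bin_small ?mulr0 //; lia.
have -> : L%:Z - 1 - i%:Z - j%:Z = (L - 1 - i - j)%N by lia.
have -> : e%:Z - j%:Z = (e - j)%N by lia.
by rewrite -invfact_bin; congr (invfact _ * _); lia.
Qed.

(** By det_invfact this is, up to a sign depending only on p, the squared Vandermonde
    product of l divided by prod_i (l_i! (L - 1 - l_i)!). *)
Definition krawtchouk_weight p L (l : {ffun 'I_p -> 'I_L.+1}) : rat :=
  \det (\matrix_(i < p, j < p) invfact ((l i)%:Z - j%:Z)) *
  \det (\matrix_(i < p, j < p) invfact (L%:Z - 1 - (l i)%:Z - j%:Z)).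

Lemma prod_expr (R : comPzRingType) (x : R) p : \prod_(i < p) x ^+ i = x ^+ (\sum_(i < p) i)%N.
Proof. by rewrite (big_morph _ (exprD x) (expr0 x)). Qed.

Lemma sum_ord_double p : ((\sum_(i < p) i).*2 = p * p.-1)%N.
Proof.
elim: p => [|p IHp]; first by rewrite big_ord0.
by rewrite big_ord_recr /= doubleD IHp; case: (p) => [|p'] /=; lia.
Qed.

Lemma polyC_det (R : comNzRingType) p (A : 'I_p -> 'I_p -> R) :
  \det (\matrix_(i, j) (A i j)%:P) = (\det (\matrix_(i, j) A i j))%:P.
Proof.
rewrite -(det_map_mx (polyC : {rmorphism R -> {poly R}})); congr (\det _).
by apply/matrixP => i j; rewrite !mxE.
Qed.

(** Andreief's identity yields a determinant with entries
    X^j (1 + X)^(L - 1 - i - j) / (L - 1 - i - j)!; multiplying row i by (1 + X)^i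
    and column j by (1 + X)^j makes the powers of 1 + X constant. *)
Lemma krawtchouk_generating_function p q :
  exists c : rat,
  \sum_(l : {ffun 'I_p -> 'I_(p + q).+1} | decreasing l)
    (krawtchouk_weight l)%:P * 'X^(\sum_i l i) =
  c%:P * 'X^(\sum_(i < p) i) * (1 + 'X) ^+ (p * q).
Proof.
set L := (p + q)%N; set b := (\sum_(i < p) i)%N.
exists (\det (\matrix_(i < p, j < p) invfact (L%:Z - 1 - i%:Z - j%:Z))).
have X1_neq0 : (1 + 'X : {poly rat}) != 0.
  by rewrite addrC -polyC1 monic_neq0 // monicXaddC.
pose A (t : 'I_L.+1) (j : 'I_p) : {poly rat} := (invfact (t%:Z - j%:Z))%:P * 'X^t.
pose B (t : 'I_L.+1) (i : 'I_p) : {poly rat} := (invfact (L%:Z - 1 - t%:Z - i%:Z))%:P.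
have termE (l : {ffun 'I_p -> 'I_L.+1}) :
    (krawtchouk_weight l)%:P * 'X^(\sum_i l i) =
    \det (\matrix_(i, j) A (l i) j) * \det (\matrix_(i, j) B (l i) j).
  rewrite polyCM -!polyC_det mulrAC; congr (_ * _).
  rewrite (big_morph _ (exprD 'X) (expr0 'X)).
  transitivity (\det (\matrix_(i < p, j < p)
      ('X^(l i) * (invfact ((l i)%:Z - j%:Z))%:P * 1 : {poly rat}))).
    by rewrite det_scale_row_col [X in _ = _ * X]big1 // mulr1 mulrC.
  by congr (\det _); apply/matrixP => i j; rewrite !mxE mulr1 mulrC.
have fact_neq0 : (p`!%:R : {poly rat}) != 0.
  by rewrite -polyC_natr polyC_eq0 pnatr_eq0 -lt0n fact_gt0.
apply: (mulfI fact_neq0).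
transitivity (p`!%:R * \det (\matrix_(i, j) \sum_t B t i * A t j)).
  rewrite -andreief mulr_natl -sum_decreasing.
  - by apply: eq_bigr => l _; apply: termE.
  - by move=> l s; rewrite !termE !det_comp_perm mulrACA -signr_addb addbb mul1r.
  - move=> l /injectivePn[i [j ij lij]].
    rewrite termE (@determinant_alternate _ _ _ i j) ?mul0r // => k.
    by rewrite !mxE lij.
congr (_ * _).
have eqM : (1 + 'X : {poly rat}) ^+ b * \det (\matrix_(i, j) \sum_t B t i * A t j) * (1 + 'X) ^+ b =
    (\det (\matrix_(i < p, j < p) invfact (L%:Z - 1 - i%:Z - j%:Z)))%:P *
    ('X^b * (1 + 'X) ^+ (L.-1 * p)).
  rewrite -!prod_expr -det_scale_row_col -polyC_det exprM.
  transitivity (\det (\matrix_(i < p, j < p)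
      (1 * (invfact (L%:Z - 1 - i%:Z - j%:Z))%:P * ('X^j * (1 + 'X) ^+ L.-1)))).
    congr (\det _); apply/matrixP => i j; rewrite !mxE /A /B sum_invfact_convolution.
    have [neg|pos] := ltrP (L%:Z - 1 - i%:Z - j%:Z) 0.
      by rewrite (invfact_lt0 neg) !(mul0r, mulr0).
    have -> : L.-1 = (i + j + (L - 1 - i - j))%N by lia.
    by rewrite !exprD; ring.
  rewrite det_scale_row_col [X in X * _ * _]big1 // mul1r big_split /=.
  by rewrite prodr_const card_ord.
(* The exponents agree since p (p + q - 1) - 2 b = p q, with 2 b = p (p - 1). *)
apply: (mulIf (expf_neq0 (b.*2) X1_neq0)).
rewrite -addnn exprD mulrA [X in X * _ = _]mulrC eqM -exprD.
rewrite -!mulrA; congr (_ * (_ * _)); rewrite -!exprD; congr (_ ^+ _).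
have := sum_ord_double p; rewrite -/b -addnn => ->.
by rewrite /L; case: (p) => [|p']; rewrite ?mul0n //=; lia.
Qed.

(** * Evaluation of the determinants by Vandermonde products *)

Definition vandermonde p (a : 'I_p -> rat) : rat :=
  \prod_(i < p) \prod_(j < p | (i < j)%N) (a j - a i).

Lemma eq_vandermonde p (a b : 'I_p -> rat) : a =1 b -> vandermonde a = vandermonde b.
Proof.
by move=> ab; apply: eq_bigr => i _; apply: eq_bigr => j _; rewrite !ab.
Qed.

(** The matrix is a product of the Vandermonde matrix and the matrix of coefficients, which is
    triangular with unit diagonal. *)
Lemma det_monic_eval p (P : nat -> {poly rat}) (a : 'I_p -> rat) :
  (forall j, P j \is monic) -> (forall j, size (P j) = j.+1) ->
  \det (\matrix_(i < p, j < p) (P j).[a i]) = vandermonde a.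
Proof.
move=> Pmonic Psize.
have trig : is_trig_mx (\matrix_(j < p, k < p) (P j)`_k).
  by apply/is_trig_mxP => j k jk; rewrite mxE nth_default // Psize.
transitivity (\det (Vandermonde p (\row_i a i))); last first.
  rewrite det_Vandermonde; apply: eq_bigr => i _; apply: eq_bigr => j _.
  by rewrite !mxE.
rewrite -det_tr -[RHS]mul1r.
rewrite -[X in X * _](_ : \det (\matrix_(j < p, k < p) (P j)`_k) = _); last first.
  rewrite det_trig // big1 // => j _; rewrite mxE.
  by have /monicP := Pmonic j; rewrite lead_coefE Psize.
rewrite -det_mulmx; congr (\det _); apply/matrixP => j i; rewrite !mxE.
rewrite (@horner_coef_wide _ p) ?Psize //.
by apply: eq_bigr => k _; rewrite !mxE.
Qed.

Definition falling_poly j : {poly rat} := \prod_(k < j) ('X - k%:R%:P).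

Lemma invfact_falling z j : invfact (z - j%:Z) = invfact z * (falling_poly j).[z%:~R].
Proof.
elim: j => [|j IHj]; first by rewrite /falling_poly big_ord0 hornerC mulr1 subr0.
rewrite /falling_poly big_ord_recr /= hornerM mulrA -IHj hornerXsubC.
have -> : z - j.+1%:Z = z - j%:Z - 1 by lia.
by rewrite invfact_pred mulrC rmorphB.
Qed.

(** Taking 1/(a_i)! out of row i leaves falling factorials of a_i, monic of degree j in column j. *)
Lemma det_invfact p (a : 'I_p -> int) :
  \det (\matrix_(i < p, j < p) invfact (a i - j%:Z)) =
  (\prod_i invfact (a i)) * vandermonde (fun i => (a i)%:~R).
Proof.
rewrite -(@det_monic_eval _ falling_poly) => [|j|j]; first last.
- by rewrite size_prod_XsubC -[RHS]addn1 addn1 /index_enum -enumT size_enum_ord.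
- exact: monic_prod_XsubC.
rewrite -[RHS]mulr1 -[X in _ = _ * X](@big1_eq _ 1 *%R _ (index_enum 'I_p) xpredT).
rewrite -det_scale_row_col; congr (\det _); apply/matrixP => i j.
by rewrite !mxE mulr1 invfact_falling.
Qed.

Lemma vandermonde_sub p c (a : 'I_p -> rat) :
  vandermonde (fun i => c - a i) =
  (\prod_(i < p) \prod_(j < p | (i < j)%N) -1) * vandermonde a.
Proof.
rewrite -big_split; apply: eq_bigr => i _ /=; rewrite -big_split.
by apply: eq_bigr => j _ /=; ring.
Qed.

Lemma vandermonde_rec p (a : 'I_p.+1 -> rat) :
  vandermonde a =
  (\prod_(i < p) (a (lift ord0 i) - a ord0)) * vandermonde (fun i => a (lift ord0 i)).
Proof.
rewrite /vandermonde big_ord_recl /=; congr (_ * _).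
  by rewrite big_mkcond big_ord_recl /= mul1r.
apply: eq_bigr => i _; rewrite big_mkcond big_ord_recl /= mul1r [RHS]big_mkcond.
by apply: eq_bigr => j _.
Qed.

Lemma invfact_sub1 (L : nat) (t : int) :
  invfact (L%:Z - 1 - t) = (L%:R - t%:~R) * invfact (L%:Z - t).
Proof. by rewrite addrAC invfact_pred rmorphB. Qed.

(** With its columns reversed, the first determinant is that of the sequence e = (L, l_0, ...,
    l_(p-1)). In the second, column 0 is zero below its top entry 1, leaving a minor in the L - l_i.
    The factors L - l_i of the Vandermonde product of e turn 1/(L - l_i)! into 1/(L - 1 - l_i)!. *)
Lemma det_shape_pair p q : exists c : rat,
  forall (l : {ffun 'I_p -> 'I_(p + q).+1}) (s : {ffun 'I_p.+1 -> nat}),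
    s ord0 = q -> (forall i, s (lift ord0 i) + p = l i + i.+1)%N ->
  \det (invfact_mx (shifted s) (shifted (empty_shape p.+1))) *
  \det (invfact_mx (shifted (full_shape p.+1 q.+1)) (shifted (incr s ord0))) =
  c * krawtchouk_weight l.
Proof.
set L := (p + q)%N.
pose rev := perm (@rev_ord_inj p.+1).
(* The sign of the column reversal, the factor 1/L! of the row e = L, and the sign from turning p
   factors l_i - L into L - l_i. *)
exists ((-1) ^+ rev * invfact L%:Z * (-1) ^+ p) => l s s0 sl.
pose e (i : 'I_p.+1) : int := if unlift ord0 i is Some i' then (l i')%:Z else L%:Z.
have e0 : e ord0 = L by rewrite /e unlift_none.
have eS i : e (lift ord0 i) = l i by rewrite /e liftK.
have -> : \det (invfact_mx (shifted s) (shifted (empty_shape p.+1))) =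
    (-1) ^+ rev * \det (\matrix_(i < p.+1, j < p.+1) invfact (e i - j%:Z)).
  rewrite -odd_permV -det_perm mulrC -det_mulmx -col_permE; congr (\det _).
  apply/matrixP => i j; rewrite !mxE permE /=; congr invfact; rewrite /shifted ffunE.
  case: (unliftP ord0 i) => [i'|] ->; rewrite ?eS ?e0 ?s0 /=.
    by have := sl i'; have := ltn_ord j; rewrite /= /bump; lia.
  by have := ltn_ord j; lia.
have -> : \det (invfact_mx (shifted (full_shape p.+1 q.+1)) (shifted (incr s ord0))) =
    \det (\matrix_(i < p, j < p) invfact (L%:Z - (l i)%:Z - j%:Z)).
  rewrite (expand_det_col _ ord0) big_ord_recl big1 ?addr0 => [|i _]; last first.
    rewrite mxE invfact_lt0 ?mul0r // /shifted !ffunE eqxx s0 /= /bump; lia.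
  rewrite mxE /shifted !ffunE eqxx s0.
  have -> : q.+1%:Z - (ord0 : 'I_p.+1)%:Z - ((q + true)%N%:Z - (ord0 : 'I_p.+1)%:Z) = 0.
    by rewrite /=; lia.
  rewrite [invfact 0]invr1 mul1r /cofactor expr0 mul1r -det_tr; congr (\det _).
  apply/matrixP => i j; rewrite !mxE /shifted !ffunE; congr invfact.
  have := sl i; rewrite eq_sym (negPf (neq_lift _ _)) /= /bump; lia.
rewrite /krawtchouk_weight !det_invfact vandermonde_rec big_ord_recl e0.
have vE (b : int) : vandermonde (fun i => (b - (l i)%:Z)%:~R) =
    (\prod_(i < p) \prod_(j < p | (i < j)%N) -1) * vandermonde (fun i => (l i)%:R).
  rewrite -(vandermonde_sub b%:~R); apply: eq_vandermonde => i.
  by rewrite rmorphB.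
rewrite !vE.
have -> : vandermonde (fun i => (e (lift ord0 i))%:~R) = vandermonde (fun i => (l i)%:R).
  by apply: eq_vandermonde => i; rewrite eS.
have -> : \prod_(i < p) invfact (e (lift ord0 i)) = \prod_(i < p) invfact (l i)%:Z.
  by apply: eq_bigr => i _; rewrite eS.
have -> : \prod_(i < p) ((e (lift ord0 i))%:~R - (L%:Z)%:~R) =
    (-1) ^+ p * \prod_(i < p) (L%:R - (l i)%:R) :> rat.
  have -> : (-1) ^+ p = \prod_(i < p) -1 :> rat by rewrite prodr_const card_ord.
  rewrite -big_split; apply: eq_bigr => i _ /=.
  by rewrite eS -!pmulrn; ring.
have -> : \prod_(i < p) invfact (L%:Z - 1 - (l i)%:Z) =
    \prod_(i < p) (L%:R - (l i)%:R) * \prod_(i < p) invfact (L%:Z - (l i)%:Z).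
  by rewrite -big_split; apply: eq_bigr => i _; rewrite invfact_sub1.
move: ((-1) ^+ rev) ((-1) ^+ p) (invfact L) (vandermonde _) => s1 s2 fL V.
move: (\prod_i _) (\prod_(i < p) (L%:R - _)) (\prod_i invfact (l i)) => P1 P2 P3.
move: (\prod_i _) => s3.
ring.
Qed.

(** * Counting tableaux by the value in the corner *)

Lemma card_cell_words m n (i : 'I_m) (j : 'I_n) k : (k < m * n)%N ->
  #|[set X in rect_tableaux m n | X i j == k.+1 :> nat]| =
  #|[set w : (m * n).-tuple 'I_m |
      [&& lattice_word n w, nth i w k == i & count_mem i (take k w) == j]]|.
Proof.
move=> kN; have m_gt0 : (0 < m)%N by case: m i {kN} => [[]|].
rewrite -(card_in_imset (f := fun w : (m * n).-tuple 'I_m => tableau_of_word n w)); last first.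
  move=> w w'; rewrite !inE => /and3P[lw _ _] /and3P[lw' _ _] eqw.
  apply: (reading_word_inj lw (reading_word_tableau_of_word lw)).
  by rewrite eqw; apply: reading_word_tableau_of_word.
apply: eq_card => X; rewrite inE; apply/andP/imsetP => [[tX Xk]|[w]].
  have [w lw rw] := tableau_reading_word m_gt0 tX; exists w.
    by rewrite inE lw -(reading_word_cell _ _ rw) ?size_tuple.
  exact: reading_word_inj_tableau rw (reading_word_tableau_of_word lw).
rewrite inE => /and3P[lw wk ck] ->; split; first exact: tableau_of_wordP.
by rewrite (reading_word_cell _ _ (reading_word_tableau_of_word lw)) ?size_tuple ?wk.
Qed.

Lemma eq_sum_tuple (V : nmodType) (I : finType) t t' (F : seq I -> V) : t = t' ->
  \sum_(w : t.-tuple I) F w = \sum_(w : t'.-tuple I) F w.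
Proof. by move->. Qed.

(** A word with letter [i] at position k splits into a path [u] before it and a path of length [r]
    from the enlarged shape to the rectangle. *)
Lemma card_cell_ballot m n (i : 'I_m) (j : 'I_n) k r : (k + r.+1 = m * n)%N ->
  #|[set X in rect_tableaux m n | X i j == k.+1 :> nat]|%:R =
  \sum_(u : k.-tuple 'I_m)
    (ballot (empty_shape m) u && (count_mem i u == j))%:R *
    num_ballot r (incr (foldl (@incr m) (empty_shape m) u) i) (full_shape m n) :> rat.
Proof.
move=> kr; rewrite card_cell_words; last by rewrite -kr; lia.
pose P (w : seq 'I_m) := [&& lattice_word n w, nth i w k == i & count_mem i (take k w) == j].
rewrite -sum1_card natr_sum big_mkcond /=.
transitivity (\sum_(w : (m * n).-tuple 'I_m) (P w)%:R : rat).
  by apply: eq_bigr => w _; rewrite inE -/(P w); case: (P w).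
rewrite (eq_sum_tuple (fun w => (P w)%:R) (esym kr)) (sum_tuple_cat _ _ (fun w => (P w)%:R)).
apply: eq_bigr => u _.
rewrite (sum_tupleS _ (fun v => (P (u ++ v))%:R)) (bigD1 i) //= [X in _ + X]big1 => [|i' ii'].
  rewrite addr0 /num_ballot mulr_sumr; apply: eq_bigr => v _.
  rewrite -natrM mulnb; congr (nat_of_bool _)%:R.
  rewrite /P /lattice_word ballot_cat foldl_cat nth_cat size_tuple ltnn subnn /= eqxx.
  rewrite take_size_cat ?size_tuple //.
  case: (boolP (ballot _ u)) => //= /ballotP/(_ k).
  rewrite take_oversize ?size_tuple // => -> /=.
  by rewrite andbC.
apply: big1 => v _.
by rewrite /P nth_cat size_tuple ltnn subnn /= (negPf ii') andbF.
Qed.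

(** * Shapes reached just before the corner entry *)

Section Corner.
Variables p q : nat.
Local Notation L := (p + q)%N.
Implicit Type l : {ffun 'I_p -> 'I_L.+1}.

Lemma decreasing_gap l (i j : 'I_p) : decreasing l -> (i <= j)%N -> (l j + j <= l i + i)%N.
Proof.
move=> /decreasingP decr; case: j => j jp /=; elim: j jp => [|j IHj] jp.
  rewrite leqn0 => /eqP i0; have -> : i = Ordinal jp by apply: val_inj.
  by rewrite /= leqnn.
rewrite leq_eqVlt => /orP[/eqP ij|].
  have -> : i = Ordinal jp by apply: val_inj.
  by rewrite /= leqnn.
have jp' := ltnW jp; rewrite ltnS => /(IHj jp').
by have /(_ (ltnSn _)) := decr (Ordinal jp') (Ordinal jp); lia.
Qed.

(** The shapes with first row q are encoded by the strictly decreasing sequences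
    l_i = lambda_(i + 1) + p - i - 1, the rows of lambda being numbered from 0. A
    sequence reaching the value L encodes a non-dominant shape and has weight 0;
    it is allowed only to have a successor as the size of the index type. *)
Definition shape_of l : {ffun 'I_p.+1 -> nat} :=
  [ffun i => if unlift ord0 i is Some i' then (l i' + i'.+1 - p)%N else q].

Lemma shape_of0 l : shape_of l ord0 = q.
Proof. by rewrite ffunE unlift_none. Qed.

Lemma shape_ofS l i : decreasing l -> (shape_of l (lift ord0 i) + p = l i + i.+1)%N.
Proof.
move=> decr; rewrite ffunE liftK subnK //.
have lt : (p.-1 < p)%N by have := ltn_ord i; lia.
have := @decreasing_gap l i (Ordinal lt) decr; rewrite /=; have := ltn_ord i; lia.
Qed.

Lemma sum_shape_of l : decreasing l ->
  (\sum_i shape_of l i + \sum_(i < p) i = q + \sum_i l i)%N.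
Proof.
move=> decr; rewrite big_ord_recl shape_of0 -addnA; congr addn.
have : (\sum_(i < p) (shape_of l (lift ord0 i) + p) = \sum_(i < p) (l i + i.+1))%N.
  by apply: eq_bigr => i _; apply: shape_ofS.
have sumS : (\sum_(i < p) i.+1 = \sum_(i < p) i + p)%N.
  rewrite (eq_bigr (fun i : 'I_p => i + 1)%N) => [|i _]; last by rewrite addn1.
  by rewrite big_split sum_nat_const card_ord muln1.
rewrite !big_split /= sumS sum_nat_const card_ord.
have := sum_ord_double p; have : (p * p = p * p.-1 + p)%N by case: p => //= p'; lia.
by move=> -> <- /eqP; rewrite -addnn !addnA !eqn_add2r => /eqP.
Qed.

Lemma dominant_shape_of l : decreasing l ->
  dominant (shape_of l) = [forall i, l i < L]%N.
Proof.
move=> decr; apply/dominantP/forallP => [dom i|lt i j].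
  have /(_ isT) := dom ord0 (lift ord0 i); rewrite shape_of0.
  by have := shape_ofS i decr; lia.
case: (unliftP ord0 i) => [i'|] ->; case: (unliftP ord0 j) => [j'|] -> //.
  rewrite /= /bump /= !add1n ltnS => ij.
  by rewrite -(leq_add2r p) !shape_ofS // !addnS ltnS; apply: decreasing_gap.
move=> _; rewrite shape_of0; have := shape_ofS j' decr.
have p0 : (0 < p)%N by have := ltn_ord j'; lia.
by have := @decreasing_gap l (Ordinal p0) j' decr isT; have := lt (Ordinal p0); rewrite /=; lia.
Qed.

(** A dominant shape with first row q has exactly one code, found by inverting [shape_of]; this
    allows paths to be grouped by code. *)
Lemma sum_eq_shape_of (s : {ffun 'I_p.+1 -> nat}) : dominant s ->
  (\sum_(l | decreasing l) (s == shape_of l)%:R = (s ord0 == q)%:R :> rat).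
Proof.
move=> /dominantP dom; case: eqVneq => [s0|s0]; last first.
  rewrite big1 // => l _; case: eqP => // sl.
  by move: s0; rewrite sl shape_of0 eqxx.
pose l0 : {ffun 'I_p -> 'I_L.+1} := [ffun i => inord (s (lift ord0 i) + p - i.+1)].
have l0E i : (l0 i = s (lift ord0 i) + p - i.+1 :> nat)%N.
  by rewrite ffunE inordK //; have := dom ord0 (lift ord0 i) isT; rewrite s0; lia.
have decr0 : decreasing l0.
  apply/decreasingP => i j ij; rewrite !l0E.
  have := dom (lift ord0 i) (lift ord0 j); rewrite /= /bump /= !add1n.
  by have := ltn_ord j; lia.
have shape0 : shape_of l0 = s.
  have shapeS (i : 'I_p) : shape_of l0 (lift ord0 i) = s (lift ord0 i).
    by have := shape_ofS i decr0; rewrite l0E subnK ?(leq_trans (ltn_ord i)) ?leq_addl // => /addIn.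
  by apply/ffunP => i; case: (unliftP ord0 i) => [i'|] ->; rewrite ?shape_of0 ?s0.
rewrite (bigD1 l0) //= shape0 eqxx big1 ?addr0 // => l /andP[decr ne].
case: eqP => // sl; case/eqP: ne; apply/ffunP => i.
by apply/val_inj; rewrite /= l0E sl shape_ofS // addnK.
Qed.

Lemma num_ballot_sum t (s s' : {ffun 'I_p.+1 -> nat}) :
  (\sum_i s' i != \sum_i s i + t)%N -> num_ballot t s s' = 0.
Proof.
move=> ne; apply: big1 => w _; case: eqP => [e|]; last by rewrite andbF.
have sumE (v : seq 'I_p.+1) : (\sum_i foldl (@incr _) s v i = \sum_i s i + size v)%N.
  elim: v (s) => [|i v IHv] s0 /=; first by rewrite addn0.
  by rewrite IHv sum_incr addSnnS.
by case/eqP: ne; rewrite -e sumE size_tuple.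
Qed.

Lemma num_ballot_to_not_dominant t (s s' : {ffun 'I_p.+1 -> nat}) :
  ~~ dominant s' -> num_ballot t s s' = 0.
Proof.
move=> ndom; apply: big1 => w _; case: eqP => [e|]; last by rewrite andbF.
case: ballotP => // /(_ t); rewrite take_oversize ?size_tuple // e => dom.
by rewrite dom in ndom.
Qed.

(** Just before an entry completes row 0, that row has q cells, so the shape reached is an encoded
    one. *)
Lemma corner_count_sum k r : (k + r.+1 = p.+1 * q.+1)%N ->
  #|[set X in rect_tableaux p.+1 q.+1 | X ord0 ord_max == k.+1 :> nat]|%:R =
  \sum_(l | decreasing l) num_ballot k (empty_shape p.+1) (shape_of l) *
    num_ballot r (incr (shape_of l) ord0) (full_shape p.+1 q.+1) :> rat.
Proof.
move=> kr; rewrite (card_cell_ballot _ _ kr).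
transitivity (\sum_(u : k.-tuple 'I_p.+1) \sum_(l | decreasing l)
   (ballot (empty_shape p.+1) u && (foldl (@incr _) (empty_shape p.+1) u == shape_of l))%:R *
    num_ballot r (incr (shape_of l) ord0) (full_shape p.+1 q.+1)); last first.
  by rewrite exchange_big; apply: eq_bigr => l _; rewrite mulr_suml.
apply: eq_bigr => u _; set s := foldl _ _ _.
case: (boolP (ballot _ u)) => [/ballotP/(_ k)|_] /=; last first.
  by rewrite mul0r big1 // => l _; rewrite mul0r.
rewrite take_oversize ?size_tuple // -/s => doms.
have -> : count_mem ord0 u = s ord0 by rewrite foldl_incrE ffunE.
rewrite -(sum_eq_shape_of doms) mulr_suml; apply: eq_bigr => l _.
by case: eqP => [->|_]; rewrite ?mul0r.
Qed.

(** Aitken's determinants and [det_shape_pair] turn each shape into a Krawtchouk weight; the size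
    condition on shapes selects one coefficient of the generating function. *)
Lemma corner_count_factorials : exists c : rat, forall k r, (k + r.+1 = p.+1 * q.+1)%N ->
  #|[set X in rect_tableaux p.+1 q.+1 | X ord0 ord_max == k.+1 :> nat]|%:R =
  c * k`!%:R * r`!%:R * (if (k < q)%N then 0 else 'C(p * q, k - q)%:R).
Proof.
have [c1 shape_pair] := det_shape_pair p q.
have [c2 genf] := krawtchouk_generating_function p q.
exists (c1 * c2) => k r kr; rewrite (corner_count_sum kr).
set b := (\sum_(i < p) i)%N.
have sum_empty : (\sum_i empty_shape p.+1 i = 0)%N by apply: big1 => i _; rewrite ffunE.
have term l : decreasing l ->
    num_ballot k (empty_shape p.+1) (shape_of l) *
    num_ballot r (incr (shape_of l) ord0) (full_shape p.+1 q.+1) =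
    c1 * k`!%:R * r`!%:R * (krawtchouk_weight l * (k + b == q + \sum_i l i)%N%:R).
  move=> decr; case: (boolP (dominant (shape_of l))) => dom; last first.
    (* Some l_i equals L, so row i of the second determinant in the weight is zero. *)
    rewrite num_ballot_to_not_dominant // mul0r.
    move: dom; rewrite dominant_shape_of // negb_forall => /existsP[i li].
    rewrite [krawtchouk_weight l]mulrC (expand_det_row _ i) big1 ?(mul0r, mulr0) // => j _.
    by rewrite mxE invfact_lt0 ?mul0r //; have := ltn_ord (l i); lia.
  have sumE := sum_shape_of decr; rewrite -sumE eqn_add2r.
  case: eqVneq => [sumk|sumk]; last first.
    by rewrite num_ballot_sum ?mul0r ?mulr0 // sum_empty add0n eq_sym.
  rewrite !num_ballotE //.
  - by rewrite mulr1 mulrACA (shape_pair l) ?shape_of0 // => [|i]; [ring | apply: shape_ofS].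
  - have incrE i : incr (shape_of l) ord0 i = (shape_of l i + (i == ord0))%N by rewrite ffunE.
    apply/dominantP => i j ij; rewrite !incrE.
    have /dominantP/(_ _ _ ij) := dom.
    have [j0|_] := eqVneq j ord0; last by move=> le; rewrite addn0 (leq_trans le) ?leq_addr.
    have -> : i = ord0 by apply/val_inj/eqP; rewrite -leqn0 (leq_trans ij) // j0.
    by rewrite j0.
  - by apply/dominantP => i j _; rewrite !ffunE.
  - rewrite sum_incr -sumk (eq_bigr (fun=> q.+1)) => [|i _]; last by rewrite ffunE.
    by rewrite sum_nat_const card_ord; lia.
  - by apply/dominantP => i j _; rewrite !ffunE.
  - by rewrite sum_empty sumk.
rewrite (eq_bigr _ term) -mulr_sumr.
(* The factor X^q makes the size condition a coefficient of index k + b, with no subtraction of q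
   from k. *)
transitivity (c1 * k`!%:R * r`!%:R *
    ('X^q * \sum_(l : {ffun 'I_p -> 'I_L.+1} | decreasing l)
      (krawtchouk_weight l)%:P * 'X^(\sum_i l i))`_(k + b)).
  congr (_ * _); rewrite mulr_sumr coef_sum; apply: eq_bigr => l _.
  by rewrite mulrCA -exprD coefCM coefXn.
rewrite genf -/b.
have -> (Y : {poly rat}) : 'X^q * (c2%:P * 'X^b * Y) = c2%:P * ('X^(q + b) * Y).
  by rewrite exprD; ring.
rewrite coefCM coefXnM coef_1addX_exp.
rewrite ltn_add2r subnDr.
by case: ltnP => _; ring.
Qed.
End Corner.

(** Since (k - q) + (r - p) = p q, both C(k, q) C(r, p) and C(p q, k - q) have (k - q)! (r - p)! as
    denominator. For k < q or r < p both sides vanish. *)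
Lemma corner_count_binomials p q : exists c : rat, forall k r, (k + r.+1 = p.+1 * q.+1)%N ->
  #|[set X in rect_tableaux p.+1 q.+1 | X ord0 ord_max == k.+1 :> nat]|%:R =
  c * ('C(k, q) * 'C(r, p))%:R.
Proof.
have [c cE] := corner_count_factorials p q.
exists (c * (p`!%:R * q`!%:R * (p * q)`!%:R)) => k r kr; rewrite (cE _ _ kr).
case: ltnP => [kq|qk]; first by rewrite bin_small // !mulr0.
have [rp|pr] := ltnP r p.
  by rewrite (bin_small rp) (bin_small (n := p * q)) ?muln0 ?mulr0 //; lia.
have kqpq : (k - q <= p * q)%N by lia.
have -> : k`! = ('C(k, q) * (q`! * (k - q)`!))%N by rewrite bin_fact.
have -> : r`! = ('C(r, p) * (p`! * (r - p)`!))%N by rewrite bin_fact.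
have -> : (p * q)`! = ('C(p * q, k - q) * ((k - q)`! * (r - p)`!))%N.
  by rewrite -(bin_fact kqpq); congr (_ * (_ * _`!))%N; lia.
by rewrite !natrM; ring.
Qed.

(** Subsets of {0, ..., n} with a + b + 1 elements, sorted by their (a + 1)-st smallest element k;
    the proof is an induction using Pascal's rule. *)
Lemma sum_bin_mul_bin n a b :
  (\sum_(k < n.+1) 'C(k, a) * 'C(n - k, b) = 'C(n.+1, (a + b).+1))%N.
Proof.
elim: n b => [|n IHn] [|b].
- by rewrite big_ord1 bin0 muln1 addn0 binS; case: a => [|[]].
- by rewrite big_ord1 muln0 bin_small //; lia.
- rewrite big_ord_recr /= bin0 muln1 addn0 binS -[a in X in _ = (X + _)%N]addn0 -IHn.
  by congr (_ + _)%N; apply: eq_bigr => k _; rewrite !bin0.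
rewrite big_ord_recr /= subnn muln0 addn0.
rewrite (eq_bigr (fun k : 'I_n.+1 => 'C(k, a) * 'C(n - k, b.+1) + 'C(k, a) * 'C(n - k, b)))%N.
  by rewrite big_split /= !IHn addnS [RHS]binS.
by move=> k _; rewrite -mulnDr subSn ?binS // -ltnS.
Qed.

(** Summing over all corner values shows that the number of tableaux is c C(N, p + q + 1);
    cross-multiplication eliminates c. *)
Lemma corner_countE p q k r : (k + r.+1 = p.+1 * q.+1)%N ->
  (#|[set X in rect_tableaux p.+1 q.+1 | X ord0 ord_max == k.+1 :> nat]| *
     'C(p.+1 * q.+1, (p + q).+1) =
   #|rect_tableaux p.+1 q.+1| * ('C(k, q) * 'C(r, p)))%N.
Proof.
move=> kr; have [c cE] := corner_count_binomials p q.
set N := (p.+1 * q.+1)%N in kr *.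
have N_gt0 : (0 < N)%N by rewrite /N muln_gt0.
have card_sum : (#|rect_tableaux p.+1 q.+1| = \sum_(i < N)
    #|[set X in rect_tableaux p.+1 q.+1 | X ord0 ord_max == i.+1 :> nat]|)%N.
  rewrite -sum1_card (partition_big (fun X : 'M['I_N.+1]_(p.+1, q.+1) =>
    X ord0 ord_max) (fun v => 0 < v)%N) => [|X tX]; last first.
    have [w lw rw] := tableau_reading_word (ltn0Sn p) tX.
    by rewrite ltnNge rw take0.
  rewrite big_mkcond big_ord_recl /= add0n; apply: eq_bigr => i _ /=.
  rewrite -sum1_card; apply: eq_bigl => X; rewrite inE.
  by rewrite -val_eqE.
apply/eqP; rewrite -(eqr_nat rat) !natrM card_sum natr_sum.
rewrite (eq_bigr (fun i : 'I_N => c * ('C(i, q) * 'C(N.-1 - i, p))%:R)); last first.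
  by move=> i _; rewrite (cE i (N.-1 - i)%N) //; have := ltn_ord i; rewrite -/N; lia.
rewrite -mulr_sumr -natr_sum.
have -> : (\sum_(i < N) 'C(i, q) * 'C(N.-1 - i, p) = 'C(N, (p + q).+1))%N.
  by have := sum_bin_mul_bin N.-1 q p; rewrite prednK // addnC.
by rewrite (cE _ _ kr) natrM; apply/eqP; ring.
Qed.

Local Open Scope classical_set_scope.
Local Open Scope ring_scope.

(** * The uniform distribution *)

(** Finite additivity over the disjoint fibres of [X] above [B]. *)
Lemma uniform_rv_setE (d : measure_display) (T : measurableType d) (R : realType)
    (P : probability T R) (U : finType) (A B : {set U}) (X : T -> U) :
  uniform_rv P A X -> B \subset A ->
  P (X @^-1` [set` B]) = (#|B|%:R / #|A|%:R)%:E.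
Proof.
move=> [_ measX PX] /fintype.subsetP BA.
have -> : X @^-1` [set` B] = \bigcup_(u in [set` enum B]) (X @^-1` [set u]).
  apply/seteqP; split => [w /= Bw|w [u /= uB]].
    by exists (X w) => //=; rewrite mem_enum.
  by rewrite mem_enum in uB => ->.
rewrite measure_fin_bigcup //; last first.
  by move=> u v _ _ [w [/= <- <-]].
rewrite -fsbig_seq ?enum_uniq // big_enum /=.
rewrite (eq_bigr (fun=> (#|A|%:R^-1)%:E)) => [|u /BA]; last exact: PX.
by rewrite sumEFin sumr_const mulr_natl.
Qed.

(* [Ordinal m_gt0] is the first row, [rev_ord (Ordinal n_gt0)] the last column. *)
Theorem theorem1 (m n : nat) (m_gt0 : (0 < m)%N) (n_gt0 : (0 < n)%N)
    (R : realType) (d : measure_display) (T : measurableType d)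
    (P : probability T R) (X : T -> 'M['I_(m * n).+1]_(m, n))
    (unifX : uniform_rv P (rect_tableaux m n) X)
    (k : nat) (k_bounds : (n <= k <= m * n - m + 1)%N) :
  P [set w | X w (Ordinal m_gt0) (rev_ord (Ordinal n_gt0)) = k :> nat] =
  (('C(k - 1, n - 1) * 'C(m * n - k, m - 1))%:R
     / 'C(m * n, m + n - 1)%:R)%:E.
Proof.
case: m n m_gt0 n_gt0 X unifX k_bounds => [//|p] [//|q] m_gt0 n_gt0 X unifX /andP[nk kmn].
have corner : rev_ord (Ordinal n_gt0) = ord_max by apply: val_inj; rewrite /= subn1.
have row0 : Ordinal m_gt0 = ord0 by apply: val_inj.
pose B : {set 'M['I_(p.+1 * q.+1).+1]_(p.+1, q.+1)} :=
  [set u in rect_tableaux p.+1 q.+1 | u ord0 ord_max == k :> nat]%SET.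
have -> : [set w | X w (Ordinal m_gt0) (rev_ord (Ordinal n_gt0)) = k :> nat] = X @^-1` [set` B].
  have [XA _ _] := unifX; rewrite corner row0.
  by apply/seteqP; split => w /=; rewrite inE XA => /eqP.
rewrite (uniform_rv_setE unifX); last by apply/fintype.subsetP => u; rewrite inE => /andP[].
(* Here k' counts the entries below k, and r those above k. *)
have [k' kE] : exists k', k = k'.+1 by exists k.-1; lia.
have [r rE] : exists r, (k' + r.+1 = p.+1 * q.+1)%N by exists (p.+1 * q.+1 - k)%N; nia.
(* The space [T] is non-empty because [P] has total mass 1, and any value of [X] is a tableau. *)
have A_neq0 : #|rect_tableaux p.+1 q.+1|%:R != 0 :> R.
  have [XA _ _] := unifX.
  have [w _] : [set: T] !=set0.
    apply/set0P/eqP => T0; have := probability_setT P; rewrite T0 measure0 => /eqP.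
    by rewrite eqe eq_sym oner_eq0.
  by rewrite pnatr_eq0 -lt0n; apply/card_gt0P; exists (X w).
have C_neq0 : 'C(p.+1 * q.+1, p.+1 + q.+1 - 1)%:R != 0 :> R.
  by rewrite pnatr_eq0 -lt0n bin_gt0; nia.
congr (_%:E); apply/eqP; rewrite eqr_div // -!natrM; apply/eqP; congr (_%:R).
have -> : (p.+1 + q.+1 - 1 = (p + q).+1)%N by lia.
have -> : (p.+1 * q.+1 - k = r)%N by lia.
by rewrite /B kE (corner_countE rE) !subn1 mulnC.
Qed.
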